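(* Let $a(x),b(x)$ be smooth real functions on a single element with $b>0$ and $c=b-a^2>0$, and let $\lambda_1=a+\sqrt b$, $\lambda_2=a-\sqrt b$. Let $\mathbf a,\mathbf b,\mathbf c,\boldsymbol\lambda_1,\boldsymbol\lambda_2\in\mathbb{R}^{(P+1)\times(P+1)}$ be the diagonal matrices of nodal values of $a,b,c,\lambda_1,\lambda_2$, and denote the first and last diagonal entries by subscripts: $b_1,b_N$ for $\mathbf b$, $\lambda_{21}$ for the first entry of $\boldsymbol\lambda_2$, $\lambda_{1N}$ for the last entry of $\boldsymbol\lambda_1$. Let $\mathbf u(t)\in\mathbb{R}^{P+1}$ solve $$\frac{d}{dt}\Big(\frac{d\mathbf u}{dt}-\mathbf aD_x\mathbf u\Big)-D_x\Big(\mathbf a\Big(\frac{d\mathbf u}{dt}-\mathbf aD_x\mathbf u\Big)+\mathbf bD_x\mathbf u\Big)=\tau_0H_x^{-1}e_le_l^T\Big(\frac{d\mathbf u}{dt}-\boldsymbol\lambda_1D_x\mathbf u\Big)+\tau_NH_x^{-1}e_re_r^T\Big(\frac{d\mathbf u}{dt}-\boldsymbol\lambda_2D_x\mathbf u\Big)$$ with penalty parameters $\tau_0=\lambda_{21}$ and $\tau_N=-\lambda_{1N}$. Then the discrete energy $$\mathcal E_c(t)=\Big(\frac{d\mathbf u}{dt}\Big)^TH_x\frac{d\mathbf u}{dt}+\mathbf u^TD_x^T\mathbf cH_xD_x\mathbf u$$ satisfies $$\frac{d}{dt}\mathcal E_c(t)=-2\sqrt{b_1}\Big(\frac{d\mathbf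 u}{dt}\Big)^Te_le_l^T\Big(\frac{d\mathbf u}{dt}\Big)-2\sqrt{b_N}\Big(\frac{d\mathbf u}{dt}\Big)^Te_re_r^T\Big(\frac{d\mathbf u}{dt}\Big)\le 0 .$$
   Context: Element operators: let $P\ge 1$, let $-1=\xi_1<\dots<\xi_{P+1}=1$ be the Gauss-Legendre-Lobatto nodes on $[-1,1]$ with positive weights $\omega_j$ (quadrature exact for polynomials of degree $\le 2P-1$), and let $\phi_i$ be the Lagrange polynomials of degree $P$ with $\phi_i(\xi_j)=\delta_{ij}$. Set $Q_{ij}=\sum_m\omega_m\phi_i(\xi_m)\phi_j'(\xi_m)$; for an element $[B_-,B_+]$ of length $\Delta x>0$ set $H_x=\frac{\Delta x}{2}\mathrm{diag}(\omega_1,\dots,\omega_{P+1})$, $D_x=H_x^{-1}Q$. The nodes of the element are the affine images of the $\xi_j$. $e_l=(1,0,\dots,0)^T$, $e_r=(0,\dots,0,1)^T\in\mathbb{R}^{P+1}$. The scheme discretises $\partial_t(u_t-au_x)-\partial_x(a(u_t-au_x)+bu_x)=0$ with homogeneous boundary conditions $u_t-\lambda_1u_x=0$ at $x=B_-$ and $u_t-\lambda_2u_x=0$ at $x=B_+$. *)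

(* Defs.v *)
From HB Require Import structures.
From mathcomp Require Export all_boot all_order all_algebra.
From mathcomp Require Export all_classical all_reals all_analysis.

Set Implicit Arguments.
Unset Strict Implicit.
Unset Printing Implicit Defensive.

Export Order.TTheory GRing.Theory Num.Theory.
Export numFieldNormedType.Exports.

Local Open Scope classical_set_scope.
Local Open Scope ring_scope.

(* Rodrigues' formula. *)
Definition legendre (R : realType) (n : nat) : {poly R} :=
  ((2 ^ n * n`!)%:R)^-1 *: (('X^2 - 1) ^+ n)^`(n).

(* The P+1 nodes are increasing zeros of (1 - x^2) L_P', which has degree P+1,
   so they are all of its zeros; [size p <= 2 * P] means deg p <= 2P - 1. *)
Record gauss_legendre_lobatto (R : realType) (P : nat)
    (xi w : 'I_P.+1 -> R) : Prop := GaussLegendreLobatto {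
  gll_increasing : forall i j : 'I_P.+1, (i < j)%N -> xi i < xi j;
  gll_first : xi ord0 = -1;
  gll_last : xi ord_max = 1;
  gll_root : forall i, root ((1 - 'X^2) * (legendre R P)^`()) (xi i);
  gll_weight_gt0 : forall i, 0 < w i;
  gll_exact : forall p : {poly R}, (size p <= 2 * P)%N ->
    \sum_i w i * p.[xi i] =
      \int[lebesgue_measure]_(x in `[(-1 : R), (1 : R)]) p.[x] }.

(* The library's Lagrange basis samples at an injective [nat -> R], whereas
   here there are only finitely many nodes. *)
Definition lagrange_poly (R : realType) (P : nat) (xi : 'I_P.+1 -> R)
    (i : 'I_P.+1) : {poly R} :=
  let p := \prod_(j < P.+1 | j != i) ('X - (xi j)%:P) in p.[xi i]^-1 *: p.

Lemma lagrange_poly_node (R : realType) (P : nat) (xi : 'I_P.+1 -> R)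
    (i j : 'I_P.+1) :
  injective xi -> (lagrange_poly xi i).[xi j] = (i == j)%:R.
Proof.
move=> xi_inj; rewrite hornerZ; set p := (\prod_(_ < _ | _) _).
have [<-|neq_ij] := eqVneq i j.
  rewrite mulVf // horner_prod; apply/prodf_neq0 => k neq_ki.
  by rewrite hornerXsubC subr_eq0 inj_eq // eq_sym.
rewrite [X in _ * X]horner_prod (bigD1 j) 1?eq_sym //=.
by rewrite hornerXsubC subrr mul0r mulr0.
Qed.

Lemma size_lagrange_poly (R : realType) (P : nat) (xi : 'I_P.+1 -> R)
    (i : 'I_P.+1) :
  injective xi -> size (lagrange_poly xi i) = P.+1.
Proof.
move=> xi_inj; rewrite size_scale; last first.
  rewrite invr_eq0 horner_prod; apply/prodf_neq0 => k neq_ki.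
  by rewrite hornerXsubC subr_eq0 inj_eq // eq_sym.
by rewrite -big_filter size_prod_XsubC -sum1_size big_filter sum1_card cardC1 card_ord.
Qed.

Definition stiffness (R : realType) (P : nat) (xi w : 'I_P.+1 -> R) :
    'M[R]_P.+1 :=
  \matrix_(i, j) \sum_(m < P.+1)
    w m * (lagrange_poly xi i).[xi m] * ((lagrange_poly xi j)^`()).[xi m].

Definition Hx (R : realType) (P : nat) (w : 'I_P.+1 -> R) (Bm Bp : R) :
    'M[R]_P.+1 :=
  ((Bp - Bm) / 2) *: diag_mx (\row_i w i).

Definition Dx (R : realType) (P : nat) (xi w : 'I_P.+1 -> R) (Bm Bp : R) :
    'M[R]_P.+1 :=
  invmx (Hx w Bm Bp) *m stiffness xi w.

Definition element_node (R : realType) (P : nat) (xi : 'I_P.+1 -> R)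
    (Bm Bp : R) (i : 'I_P.+1) : R :=
  Bm + (Bp - Bm) / 2 * (xi i + 1).

Definition nodal_mx (R : realType) (P : nat) (xi : 'I_P.+1 -> R) (Bm Bp : R)
    (f : R -> R) : 'M[R]_P.+1 :=
  diag_mx (\row_i f (element_node xi Bm Bp i)).

Definition e_l (R : realType) (P : nat) : 'cV[R]_P.+1 := delta_mx ord0 0.
Definition e_r (R : realType) (P : nat) : 'cV[R]_P.+1 := delta_mx ord_max 0.

(* [f] agrees on [A] with a C^oo function on the whole line, so the values of
   [f] outside [A] are irrelevant. *)
Definition smooth_on (R : realType) (A : set R) (f : R -> R) : Prop :=
  exists2 g : R -> R,
    (forall (n : nat) (x : R), derivable (derive1n n g) x 1) &
    {in A, f =1 g}.

Definition coef_c (R : realType) (a b : R -> R) (x : R) : R := b x - a x ^+ 2.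
Definition lambda1 (R : realType) (a b : R -> R) (x : R) : R :=
  a x + Num.sqrt (b x).
Definition lambda2 (R : realType) (a b : R -> R) (x : R) : R :=
  a x - Num.sqrt (b x).

Definition solves_scheme (R : realType) (P : nat) (xi w : 'I_P.+1 -> R)
    (Bm Bp : R) (a b : R -> R) (tau0 tauN : R) (I : set R)
    (u : R -> 'cV[R]_P.+1) : Prop :=
  let H := Hx w Bm Bp in
  let D := Dx xi w Bm Bp in
  let diag := nodal_mx xi Bm Bp in
  let v := fun s : R => derive1 u s - diag a *m D *m u s in
  forall t, I t ->
    [/\ derivable u t 1, derivable v t 1 &
      derive1 v t - D *m (diag a *m v t + diag b *m D *m u t) =
        tau0 *: (invmx H *m e_l R P *m (e_l R P)^T *m
          (derive1 u t - diag (lambda1 a b) *m D *m u t))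
        + tauN *: (invmx H *m e_r R P *m (e_r R P)^T *m
          (derive1 u t - diag (lambda2 a b) *m D *m u t))].

Definition energy_c (R : realType) (P : nat) (xi w : 'I_P.+1 -> R)
    (Bm Bp : R) (a b : R -> R) (u : R -> 'cV[R]_P.+1) (t : R) : R :=
  let H := Hx w Bm Bp in
  let D := Dx xi w Bm Bp in
  ((derive1 u t)^T *m H *m derive1 u t
    + (u t)^T *m D^T *m nodal_mx xi Bm Bp (coef_c a b) *m H *m D *m u t) 0 0.

(* Main.v *)
(* Exactness of the quadrature on (phi_i phi_j)' gives summation by parts
   Q + Q^T = e_r e_r^T - e_l e_l^T, so that with p = u' and g = D u half the
   energy rate is p^T (Q + Q^T) (a p + c g) plus the penalty terms.  Since
   lambda_1 lambda_2 = - c, the chosen penalties cancel the boundary products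
   p c g and turn the boundary coefficients a of p^2 into
   lambda_2 - a = - sqrt b on the left and a - lambda_1 = - sqrt b on the
   right. *)
Require Import Defs.
From mathcomp Require Import ring lra.

Set Implicit Arguments.
Unset Strict Implicit.
Unset Printing Implicit Defensive.

Local Open Scope classical_set_scope.
Local Open Scope ring_scope.

(** * Derivatives of matrix expressions and integrals of polynomial derivatives *)

Lemma is_derive_mxP (R : realFieldType) (V : normedModType R) (m n : nat)
    (M : V -> 'M[R]_(m, n)) (dM : 'M[R]_(m, n)) (t v : V) :
  is_derive t v M dM <->
  forall i j, is_derive t v (fun s => M s i j) (dM i j).
Proof.
split=> [[Mt <-] i j|Mij].
  split; first exact: (derivable_mxP M t v).1.
  by rewrite derive_mx// mxE.
have Mt : derivable M t v by apply/derivable_mxP => i j; case: (Mij i j).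
split=> //; rewrite derive_mx//.
by apply/matrixP => i j; rewrite mxE derive_val.
Qed.

Lemma is_derive_mulmx (R : realFieldType) (V : normedModType R) (m n q : nat)
    (M : V -> 'M[R]_(m, n)) (N : V -> 'M[R]_(n, q)) (dM : 'M[R]_(m, n))
    (dN : 'M[R]_(n, q)) (t v : V) :
  is_derive t v M dM -> is_derive t v N dN ->
  is_derive t v (fun s => M s *m N s) (dM *m N t + M t *m dN).
Proof.
move=> /is_derive_mxP dMij /is_derive_mxP dNij.
apply/is_derive_mxP => i k.
have -> : (fun s => (M s *m N s) i k) =
    \sum_(j < n) ((fun s => M s i j) * (fun s => N s j k)).
  by apply/funext => s; rewrite mxE fct_sumE.
have dMN j := is_deriveM (dMij i j) (dNij j k).
have dsum := is_derive_sum dMN.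
apply: is_derive_eq.
rewrite !mxE -big_split/=; apply: eq_bigr => j _.
by rewrite addrC; congr (_ + _); rewrite /GRing.scale/= mulrC.
Qed.

Lemma is_derive_mulmxl (R : realFieldType) (V : normedModType R)
    (m n q : nat) (M : 'M[R]_(m, n)) (N : V -> 'M[R]_(n, q))
    (dN : 'M[R]_(n, q)) (t v : V) :
  is_derive t v N dN -> is_derive t v (fun s => M *m N s) (M *m dN).
Proof.
move=> dNt; have dMN := is_derive_mulmx (is_derive_cst M t v) dNt.
by apply: is_derive_eq; rewrite mul0mx add0r.
Qed.

Lemma is_derive_trmx (R : realFieldType) (V : normedModType R) (m n : nat)
    (M : V -> 'M[R]_(m, n)) (dM : 'M[R]_(m, n)) (t v : V) :
  is_derive t v M dM -> is_derive t v (fun s => (M s)^T) dM^T.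
Proof.
move=> /is_derive_mxP dMij; apply/is_derive_mxP => i j; rewrite mxE.
by under eq_fun do rewrite mxE.
Qed.

Lemma trmx_bilinear (R : comPzRingType) (m n : nat) (x : 'cV[R]_m)
    (M : 'M[R]_(m, n)) (y : 'cV[R]_n) :
  (x^T *m M *m y) 0 0 = (y^T *m M^T *m x) 0 0.
Proof. by rewrite -[in LHS](trmxK (_ *m y)) mxE !trmx_mul trmxK mulmxA. Qed.

(** The product rule gives two terms that are transposes of each other; symmetry of [M] makes them
    equal as scalars, hence the factor 2. *)
Lemma is_derive_quadratic_form (R : realFieldType) (n : nat)
    (y : R -> 'cV[R]_n) (dy : 'cV[R]_n) (M : 'M[R]_n) (t : R) :
  M^T = M -> is_derive t 1 y dy ->
  is_derive t 1 (fun s => ((y s)^T *m M *m y s) 0 0)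
    (2 * ((y t)^T *m M *m dy) 0 0).
Proof.
move=> Msym dyt.
have dyM := is_derive_mulmx (is_derive_mulmx (is_derive_trmx dyt)
  (is_derive_cst M t 1)) dyt.
have dyM00 := (is_derive_mxP _ _ _ _).1 dyM 0 0.
apply: is_derive_eq.
rewrite mulmx0 addr0 mxE trmx_bilinear Msym; ring.
Qed.

Lemma Rintegral_horner_deriv (R : realType) (x y : R) (p : {poly R}) :
  x < y ->
  \int[lebesgue_measure]_(z in `[x, y]) p^`().[z] = p.[y] - p.[x].
Proof.
move=> xy; rewrite /Rintegral (@continuous_FTC2 _ _ (horner p))//.
- exact/continuous_subspaceT/continuous_horner.
- split=> [z _||]; first exact: derivable_horner.
  + exact/cvg_at_right_filter/continuous_horner.
  + exact/cvg_at_left_filter/continuous_horner.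
- by move=> z _; rewrite derivE.
Qed.

(** * Summation by parts and diagonal operators on one element *)

Section element_operators.
Context (R : realType) (P : nat) (xi w : 'I_P.+1 -> R)
  (hgll : gauss_legendre_lobatto xi w).

Lemma gll_inj : injective xi.
Proof.
move=> i j xij; apply/val_inj/eqP; rewrite eqn_leq.
by apply/andP; split; rewrite leqNgt; apply/negP => /(gll_increasing hgll);
  rewrite xij ltxx.
Qed.

(** Each entry is the quadrature of a total derivative, so exactness reduces it to end values, which
    are Kronecker deltas because both endpoints are nodes. *)
Lemma stiffness_sbp :
  stiffness xi w + (stiffness xi w)^T =
  e_r R P *m (e_r R P)^T - e_l R P *m (e_l R P)^T.
Proof.
apply/matrixP => i j.
transitivity (\sum_m w m *
    (lagrange_poly xi i * lagrange_poly xi j)^`().[xi m]).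
  rewrite !mxE -big_split/=; apply: eq_bigr => m _.
  rewrite derivM hornerD !hornerM; ring.
rewrite (gll_exact hgll); last first.
  (* The product has size at most [2 * P + 1], and differentiation lowers the size strictly only
     when the polynomial is nonzero. *)
  have [->|nz] := eqVneq (lagrange_poly xi i * lagrange_poly xi j) 0.
    by rewrite deriv0 size_poly0.
  rewrite -ltnS (leq_trans (lt_size_deriv nz))//.
  rewrite (leq_trans (size_polyMleq _ _))//.
  by rewrite !size_lagrange_poly ?addnS ?addSn/= ?mul2n ?addnn//;
    exact: gll_inj.
(* The endpoints become nodes again; [-1] is replaced before [1], which occurs inside it. *)
rewrite Rintegral_horner_deriv ?gtrN// !hornerM -(gll_first hgll).
rewrite -(gll_last hgll) !lagrange_poly_node; [|exact: gll_inj..].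
by rewrite !mxE !big_ord1 !mxE !eqxx !andbT.
Qed.

Section nonempty_element.
Context (Bm Bp : R) (hB : Bm < Bp).

Lemma Hx_unit : Hx w Bm Bp \in unitmx.
Proof.
have h_gt0 : 0 < (Bp - Bm) / 2 by rewrite divr_gt0// subr_gt0.
rewrite unitmxE unitfE /Hx detZ det_diag mulf_neq0//.
  by rewrite expf_neq0// gt_eqF.
by apply/prodf_neq0 => i _; rewrite mxE gt_eqF// (gll_weight_gt0 hgll).
Qed.

Lemma mul_Hx_Dx : Hx w Bm Bp *m Dx xi w Bm Bp = stiffness xi w.
Proof. by rewrite /Dx mulKVmx// Hx_unit. Qed.

(** Since the nodes increase from -1 to 1, their affine images stay in the element; this makes the
    positivity of [b] available at the nodes. *)
Lemma element_node_itv (i : 'I_P.+1) :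
  element_node xi Bm Bp i \in `[Bm, Bp].
Proof.
have xi_ge : -1 <= xi i.
  rewrite -(gll_first hgll); have [->//|i0] := eqVneq i ord0.
  by apply/ltW/(gll_increasing hgll); rewrite lt0n.
have xi_le : xi i <= 1.
  rewrite -(gll_last hgll); have [->//|im] := eqVneq i ord_max.
  by apply/ltW/(gll_increasing hgll); rewrite ltn_neqAle im -ltnS ltn_ord.
move: hB; rewrite in_itv/= /element_node => hlt.
by apply/andP; split; nra.
Qed.

End nonempty_element.

Lemma Hx_sym (Bm Bp : R) : (Hx w Bm Bp)^T = Hx w Bm Bp.
Proof. by rewrite /Hx linearZ/= tr_diag_mx. Qed.

Lemma nodal_mx_sym (Bm Bp : R) (f : R -> R) :
  (nodal_mx xi Bm Bp f)^T = nodal_mx xi Bm Bp f.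
Proof. exact: tr_diag_mx. Qed.

Lemma nodal_mxE (Bm Bp : R) (f : R -> R) (i : 'I_P.+1) :
  nodal_mx xi Bm Bp f i i = f (element_node xi Bm Bp i).
Proof. by rewrite !mxE eqxx mulr1n. Qed.

Lemma mul_nodal_mxE (Bm Bp : R) (f : R -> R) (x : 'cV[R]_P.+1) i j :
  (nodal_mx xi Bm Bp f *m x) i j = f (element_node xi Bm Bp i) * x i j.
Proof. by rewrite mul_diag_mx !mxE. Qed.

Lemma nodal_mx_Hx_comm (Bm Bp : R) (f : R -> R) :
  nodal_mx xi Bm Bp f *m Hx w Bm Bp = Hx w Bm Bp *m nodal_mx xi Bm Bp f.
Proof. by rewrite /Hx -scalemxAl -scalemxAr diag_mxC. Qed.

Lemma nodal_mx_coef_c (Bm Bp : R) (a b : R -> R) :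
  nodal_mx xi Bm Bp (coef_c a b) =
  nodal_mx xi Bm Bp b - nodal_mx xi Bm Bp a *m nodal_mx xi Bm Bp a.
Proof.
rewrite mulmx_diag -linearB/=; congr diag_mx.
by apply/rowP => i; rewrite !mxE.
Qed.

End element_operators.

(** * Boundary terms and the energy balance *)

Lemma e_l_form (R : realType) (P : nat) (x y : 'cV[R]_P.+1) :
  (x^T *m e_l R P *m (e_l R P)^T *m y) 0 0 = x ord0 0 * y ord0 0.
Proof.
by rewrite -mulmxA -colE trmx_delta -rowE mxE big_ord1 !mxE.
Qed.

Lemma e_r_form (R : realType) (P : nat) (x y : 'cV[R]_P.+1) :
  (x^T *m e_r R P *m (e_r R P)^T *m y) 0 0 = x ord_max 0 * y ord_max 0.
Proof.
by rewrite -mulmxA -colE trmx_delta -rowE mxE big_ord1 !mxE.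
Qed.

Lemma stiffness_boundary (R : realType) (P : nat) (xi w : 'I_P.+1 -> R)
    (x y : 'cV[R]_P.+1) :
  gauss_legendre_lobatto xi w ->
  (x^T *m stiffness xi w *m y) 0 0 + (y^T *m stiffness xi w *m x) 0 0 =
  x ord_max 0 * y ord_max 0 - x ord0 0 * y ord0 0.
Proof.
move=> hgll; rewrite (trmx_bilinear y) -e_l_form -e_r_form.
have subE (M N : 'M[R]_1) : (M - N) 0 0 = M 0 0 - N 0 0 by rewrite !mxE.
rewrite -subE -!mulmxA -mulmxBr !mulmxA -mulmxBl -(stiffness_sbp hgll).
by rewrite mulmxDl mulmxDr !mulmxA [RHS]mxE.
Qed.

Theorem theorem13 (R : realType) (P : nat) (hP : (1 <= P)%N)
    (xi w : 'I_P.+1 -> R) (hgll : gauss_legendre_lobatto xi w)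
    (Bm Bp : R) (hB : Bm < Bp)
    (a b : R -> R)
    (ha : smooth_on `[Bm, Bp] a) (hb : smooth_on `[Bm, Bp] b)
    (hb_gt0 : forall x, x \in `[Bm, Bp] -> 0 < b x)
    (hc_gt0 : forall x, x \in `[Bm, Bp] -> 0 < coef_c a b x)
    (I : set R) (hI : open I) (u : R -> 'cV[R]_P.+1)
    (hu : solves_scheme xi w Bm Bp a b
      (nodal_mx xi Bm Bp (lambda2 a b) ord0 ord0)
      (- nodal_mx xi Bm Bp (lambda1 a b) ord_max ord_max) I u) :
  forall t, I t ->
    let b_1 := nodal_mx xi Bm Bp b ord0 ord0 in
    let b_N := nodal_mx xi Bm Bp b ord_max ord_max in
    let rate :=
      - 2 * Num.sqrt b_1 *
          ((derive1 u t)^T *m e_l R P *m (e_l R P)^T *m derive1 u t) 0 0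
      - 2 * Num.sqrt b_N *
          ((derive1 u t)^T *m e_r R P *m (e_r R P)^T *m derive1 u t) 0 0 in
    [/\ derivable (energy_c xi w Bm Bp a b u) t 1,
        derive1 (energy_c xi w Bm Bp a b u) t = rate & rate <= 0].
Proof.
move=> t It b_1 b_N rate.
move: (hu t It) => /=.
set H := Hx w Bm Bp; set D := Dx xi w Bm Bp.
set A := nodal_mx xi Bm Bp a; set B := nodal_mx xi Bm Bp b.
set v := (fun s : R => _); move=> [ut vt scheme].
set p := derive1 u.
set C := nodal_mx xi Bm Bp (coef_c a b).
have du : is_derive t 1 u (p t).
  by split; [exact: ut|rewrite /p derive1E].
have dDu := is_derive_mulmxl D du.
have dv : is_derive t 1 v (derive1 v t).
  by split; [exact: vt|rewrite derive1E].
(* The scheme provides derivatives of [u] and [v] only; [u'] is differentiable because it equals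
   [v + A D u]. *)
have dp : is_derive t 1 p (derive1 v t + A *m (D *m p t)).
  rewrite [X in is_derive _ _ X _](_ : p = v + (fun s => A *m (D *m u s))).
  2: by apply/funext => s /=; rewrite fctE /v mulmxA subrK.
  exact: is_deriveD dv (is_derive_mulmxl A dDu).
(* Diagonal matrices commute, so the potential energy is a symmetric quadratic form in [D u]. *)
have CHsym : (C *m H)^T = C *m H.
  by rewrite trmx_mul nodal_mx_sym Hx_sym nodal_mx_Hx_comm.
have dE := is_deriveD (is_derive_quadratic_form (Hx_sym w Bm Bp) dp)
  (is_derive_quadratic_form CHsym dDu).
have {dE} dE : is_derive t 1 (energy_c xi w Bm Bp a b u) rate.
  rewrite (_ : energy_c _ _ _ _ _ _ _ =
      (fun s => ((p s)^T *m H *m p s) 0 0) +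
      (fun s => ((D *m u s)^T *m (C *m H) *m (D *m u s)) 0 0)); last first.
    by apply/funext => s; rewrite fctE /energy_c mxE (trmx_mul D (u s)) !mulmxA.
  apply: is_derive_eq; rewrite -mulrDr.
  set g := D *m u t; set q := p t.
  have HD : H *m D = stiffness xi w by exact: mul_Hx_Dx.
  set Q := stiffness xi w in HD.
  (* This is the scheme multiplied by [H]: the factors [invmx H] cancel and [H D] becomes [Q]. The
     extra [A Q q] comes from [A D u'], with [A] and [H] exchanged. *)
  have Hvq : H *m (derive1 v t + A *m (D *m q)) =
      Q *m (A *m q + C *m g) + A *m Q *m q
      + (nodal_mx xi Bm Bp (lambda2 a b) ord0 ord0 *:
          (e_l R P *m (e_l R P)^T *m
             (q - nodal_mx xi Bm Bp (lambda1 a b) *m g))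
        - nodal_mx xi Bm Bp (lambda1 a b) ord_max ord_max *:
          (e_r R P *m (e_r R P)^T *m
             (q - nodal_mx xi Bm Bp (lambda2 a b) *m g))).
    (* Substituting [v = q - A g] into the flux leaves [B - A A = C] in front of [g]. *)
    have Av : A *m v t + B *m D *m u t = A *m q + C *m g.
      rewrite /C nodal_mx_coef_c -/A -/B /v mulmxBr mulmxBl.
      by rewrite -(mulmxA A D) -(mulmxA B D) -(mulmxA A A) addrAC addrA.
    move/eqP: scheme; rewrite subr_eq Av => /eqP ->.
    have HV (z : 'cV[R]_P.+1) : H *m (invmx H *m z) = z.
      exact: mulKVmx (Hx_unit hgll hB) z.
    rewrite !(mulmxDr H) -!(scalemxAr _ H) (mulmxA H D) HD.
    rewrite (mulmxA H A) -nodal_mx_Hx_comm -(mulmxA A H) (mulmxA H D) HD.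
    rewrite (mulmxA A Q) -!(mulmxA (invmx H) _ (_^T)).
    rewrite -!(mulmxA (invmx H) (_ *m _)) !HV scaleNr.
    by rewrite -addrA addrC -!(mulmxA _ D (u t)).
  (* The rest is algebra in which [g] may be any vector satisfying [Hvq]. *)
  clearbody g.
  (* These split the entry of a sum while keeping the matrix products inside folded. *)
  have addE (M N : 'M[R]_1) : (M + N) 0 0 = M 0 0 + N 0 0 by rewrite mxE.
  have subE (M N : 'M[R]_1) : (M - N) 0 0 = M 0 0 - N 0 0 by rewrite !mxE.
  have scaleE k (M : 'M[R]_1) : (k *: M) 0 0 = k * M 0 0 by rewrite mxE.
  have CHD : g^T *m (C *m H) *m (D *m q) = (C *m g)^T *m Q *m q.
    rewrite (trmx_mul C g) nodal_mx_sym -HD (mulmxA _ C H).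
    by rewrite (mulmxA _ D q) (mulmxA _ H D).
  have AQ : q^T *m (A *m Q *m q) = (A *m q)^T *m Q *m q.
    by rewrite (trmx_mul A q) nodal_mx_sym !mulmxA.
  have trD : (A *m q + C *m g)^T = (A *m q)^T + (C *m g)^T by exact: linearD.
  (* The terms [(A q)^T Q q] and [(C g)^T Q q] add up to the transposed flux against [Q q], which
     pairs with [q^T Q] applied to the flux as summation by parts requires. *)
  have -> : (q^T *m H *m (derive1 v t + A *m (D *m q))) 0 0
        + (g^T *m (C *m H) *m (D *m q)) 0 0 =
      ((q^T *m Q *m (A *m q + C *m g)) 0 0
        + ((A *m q + C *m g)^T *m Q *m q) 0 0)
      + (nodal_mx xi Bm Bp (lambda2 a b) ord0 ord0 *
          (q^T *m e_l R P *m (e_l R P)^T *m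
             (q - nodal_mx xi Bm Bp (lambda1 a b) *m g)) 0 0
        - nodal_mx xi Bm Bp (lambda1 a b) ord_max ord_max *
          (q^T *m e_r R P *m (e_r R P)^T *m
             (q - nodal_mx xi Bm Bp (lambda2 a b) *m g)) 0 0).
    rewrite CHD -(mulmxA q^T H) Hvq !(mulmxDr q^T) (mulmxN q^T) AQ.
    rewrite -!(scalemxAr _ q^T) trD !(mulmxDl _ _ Q) !(mulmxDl _ _ q).
    rewrite !mulmxA !(subE, addE, scaleE); ring.
  rewrite (stiffness_boundary _ _ hgll) e_l_form e_r_form.
  have fluxE k : (A *m q + C *m g) k 0 = a (element_node xi Bm Bp k) * q k 0
      + coef_c a b (element_node xi Bm Bp k) * g k 0.
    by rewrite mxE !mul_nodal_mxE.
  have jumpE f k : (q - nodal_mx xi Bm Bp f *m g) k 0 =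
      q k 0 - f (element_node xi Bm Bp k) * g k 0.
    by rewrite mxE [X in _ + X]mxE mul_nodal_mxE.
  rewrite !fluxE !jumpE /rate /b_1 /b_N e_l_form e_r_form !nodal_mxE.
  rewrite -/(p t) -/q.
  have sq_sqrt k :
      b (element_node xi Bm Bp k) = Num.sqrt (b (element_node xi Bm Bp k)) ^+ 2.
    by rewrite sqr_sqrtr// ltW// hb_gt0// (element_node_itv hgll hB).
  rewrite /coef_c /lambda1 /lambda2.
  (* With [s = sqrt b] and [c = s^2 - a^2], the left end reads [-q (a q + c g) + (a - s) q (q - (a +
     s) g) = -s q^2]; the right end reads [q (a q + c g) - (a + s) q (q - (a - s) g) = -s q^2]. *)
  ring: (sq_sqrt ord0) (sq_sqrt ord_max).
have [Et Erate] := dE.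
split; [exact: Et|rewrite derive1E; exact: Erate|].
rewrite /rate e_l_form e_r_form -!expr2 !mulNr -opprD oppr_le0.
by apply: addr_ge0; apply: mulr_ge0 (sqr_ge0 _); apply: mulr_ge0 (sqrtr_ge0 _).
Qed.
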